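(* Let $\boldsymbol\lambda^*\in\mathbb R^{\mathcal A}$ be the optimal solution of the dual problem $$\min_{\boldsymbol\lambda\in\mathbb R^{\mathcal A}}\ g_n(\boldsymbol\lambda)+g_z(\boldsymbol\lambda),$$ where $$g_n(\boldsymbol\lambda)=\max_{\mathbf n\ge0}\ \sum_{k\in\mathcal A}n_k(\lambda_k-\log n_k),$$ and $g_z(\boldsymbol\lambda)$ is the optimal value of $$\max_{\mathbf z}\ \sum_{k\in\mathcal A}\sum_{(i,j)\in T}(b_{ijk}-\lambda_kw_{ij})z_{ijk}$$ subject to $z_{ijk}\in[0,1]$ for all $(i,j)\in T$, $k\in\mathcal A$; $\sum_{k\in\mathcal A}\sum_{j\in\mathcal C_+'}z_{ijk}=1$ for all $i\in\mathcal C_-$; and $\sum_{k\in\mathcal A}\sum_{i\in\mathcal C_-'}z_{ijk}=1$ for all $j\in\mathcal C_+$. Let $\mathbf n^*(\boldsymbol\lambda^* )$ and $\mathbf z^*(\boldsymbol\lambda^* )$ be maximizers of the problems defining $g_n(\boldsymbol\lambda^* )$ and $g_z(\boldsymbol\lambda^* )$, respectively. If the maximizer $\mathbf z^*(\boldsymbol\lambda^* )$ of the problem defining $g_z(\boldsymbol\lambda^* )$ is unique, then $(\mathbf z^*(\boldsymbol\lambda^* ),\mathbf n^*(\boldsymbol\lambda^* ))$ is an optimal solution of the mixed-integer problem $$\max_{\mathbf z,\mathbf n}\ \sum_{k\in\mathcal A}\sum_{(i,j)\in T}b_{ijk}z_{ijk}-\sum_{k\in\mathcal A}n_k\log n_k$$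 subject to $z_{ijk}\in\{0,1\}$ for all $(i,j)\in T$, $k\in\mathcal A$; $\sum_{k\in\mathcal A}\sum_{j\in\mathcal C_+'}z_{ijk}=1$ for all $i\in\mathcal C_-$; $\sum_{k\in\mathcal A}\sum_{i\in\mathcal C_-'}z_{ijk}=1$ for all $j\in\mathcal C_+$; and $n_k=\sum_{(i,j)\in T}w_{ij}z_{ijk}$ for all $k\in\mathcal A$.
   Context: $\mathcal A$ (access points), $\mathcal C_-$ (clients) and $\mathcal C_+$ (relays) are finite sets, $\mathcal A\neq\emptyset$. A virtual client $u$ and a virtual relay $v$ are added: $\mathcal C_-'=\mathcal C_-\cup\{u\}$, $\mathcal C_+'=\mathcal C_+\cup\{v\}$, and $T=(\mathcal C_-'\times\mathcal C_+')\setminus\{(u,v)\}$ (in sums over $\mathcal C_+'$ or $\mathcal C_-'$ in the constraints, the pair $(u,v)$ never occurs). The weights are $w_{ij}=2$ if $i\in\mathcal C_-$ and $j\in\mathcal C_+$, and $w_{ij}=1$ otherwise. Convention: $0\log0=0$. The utilities $b_{ijk}\in\mathbb R$ are built from given positive rates $\hat c_{ik},\hat c_{ij},\hat c_{jk}$ ($i\in\mathcal C_-$, $j\in\mathcal C_+$, $k\in\mathcal A$) by $b_{ivk}=\log a_{ik}$, $b_{ujk}=\log a_{jk}$, $b_{ijk}=\log(a_{ijk}a_{jk})$, where $a_{ik}=\hat c_{ik}$, $a_{jk}=\hat c_{jk}$, and $$a_{ijk}=\begin{cases}\hat c_{jk}&\text{if }2\hat c_{ij}\ge\hat c_{jk},\\[2pt]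 \dfrac{4(\hat c_{jk}-\hat c_{ij})\hat c_{ij}}{\hat c_{jk}}&\text{if }2\hat c_{ij}<\hat c_{jk}.\end{cases}$$ *)

(* Defs.v *)
From mathcomp Require Import all_boot all_order all_algebra.
From mathcomp Require Import boolp classical_sets reals exp.

Set Implicit Arguments.
Unset Strict Implicit.
Unset Printing Implicit Defensive.

Import Order.TTheory GRing.Theory Num.Theory.
Local Open Scope classical_set_scope.
Local Open Scope ring_scope.

Section Optimization.
Variables (R : realType) (X : Type).

Definition is_maximizer (S : set X) (f : X -> R) (x : X) : Prop :=
  S x /\ forall y, S y -> f y <= f x.

Definition is_minimizer (S : set X) (f : X -> R) (x : X) : Prop :=
  S x /\ forall y, S y -> f x <= f y.

(* [sup] is 0 by convention on a set that is empty or unbounded above. In both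
   uses below the maximum is attained, so this is the genuine optimal value:
   each n_k (lam_k - ln n_k) is maximal at n_k = exp (lam_k - 1), and the
   assignment polytope is compact, and nonempty as soon as A is. *)
Definition max_value (S : set X) (f : X -> R) : R := sup (f @` S).

End Optimization.

Section Network.
(* A: access points, Cm: clients, Cp: relays. *)
Variables (R : realType) (A Cm Cp : finType).

(* [None : option Cm] is the virtual client u, [None : option Cp] is the
   virtual relay v, so this is T = (Cm' x Cp') \ {(u, v)}. It is a subtype
   so that z has no coordinate at (u, v), which would spoil uniqueness of the
   maximizers. *)
Definition link : Type :=
  {p : option Cm * option Cp | p != (None, None)}.

Definition client (t : link) : option Cm := (val t).1.
Definition relay (t : link) : option Cp := (val t).2.

Definition weight (t : link) : R :=
  if (client t, relay t) is (Some _, Some _) then 2 else 1.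

Section Utility.
(* The rates \hat c_{ik}, \hat c_{ij}, \hat c_{jk}. *)
Variables (cik : Cm -> A -> R) (cij : Cm -> Cp -> R) (cjk : Cp -> A -> R).

Definition relay_rate (i : Cm) (j : Cp) (k : A) : R :=
  if cjk j k <= 2 * cij i j then cjk j k
  else 4 * (cjk j k - cij i j) * cij i j / cjk j k.

Definition utility (t : link) (k : A) : R :=
  match client t, relay t with
  | Some i, None => ln (cik i k)
  | None, Some j => ln (cjk j k)
  | Some i, Some j => ln (relay_rate i j k * cjk j k)
  | None, None => 0 (* impossible in [link] *)
  end.

End Utility.

(* The coordinate z_{ijk} is [z (t, k)] with t = (i, j) in T. *)
Definition assignment : Type := {ffun link * A -> R}.

Definition clients_assigned (z : assignment) : Prop :=
  forall i : Cm,
    \sum_(k : A) \sum_(t : link | client t == Some i) z (t, k) = 1.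

Definition relays_assigned (z : assignment) : Prop :=
  forall j : Cp,
    \sum_(k : A) \sum_(t : link | relay t == Some j) z (t, k) = 1.

Definition relaxed_feasible : set assignment :=
  [set z : assignment |
    [/\ forall t k, 0 <= z (t, k) <= 1,
        clients_assigned z & relays_assigned z]].

Definition nonneg_loads : set {ffun A -> R} :=
  [set n | forall k, 0 <= n k].

(* The convention 0 log 0 = 0 holds here since [ln 0] is a real number. *)
Definition gn_objective (lam n : {ffun A -> R}) : R :=
  \sum_(k : A) n k * (lam k - ln (n k)).

Definition gn (lam : {ffun A -> R}) : R :=
  max_value nonneg_loads (gn_objective lam).

Definition mip_feasible : set (assignment * {ffun A -> R}) :=
  [set zn : assignment * {ffun A -> R} |
    [/\ forall t k, zn.1 (t, k) = 0 \/ zn.1 (t, k) = 1,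
        clients_assigned zn.1, relays_assigned zn.1 &
        forall k, zn.2 k = \sum_(t : link) weight t * zn.1 (t, k)]].

Section Objectives.
Variable b : link -> A -> R.

Definition gz_objective (lam : {ffun A -> R}) (z : assignment) : R :=
  \sum_(k : A) \sum_(t : link) (b t k - lam k * weight t) * z (t, k).

Definition gz (lam : {ffun A -> R}) : R :=
  max_value relaxed_feasible (gz_objective lam).

Definition dual_objective (lam : {ffun A -> R}) : R := gn lam + gz lam.

Definition mip_objective (zn : assignment * {ffun A -> R}) : R :=
  \sum_(k : A) \sum_(t : link) b t k * zn.1 (t, k)
  - \sum_(k : A) zn.2 k * ln (zn.2 k).

End Objectives.
End Network.

(* Main.v *)
(** The relaxed assignment polytope is the fractional perfect matching polytope
    of a bipartite multigraph, some of whose edges dangle at the unconstrained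
    nodes u and v, so every linear objective is maximized at an integral point.
    Hence the unique maximizer z at the dual optimum lam is integral, and, as
    there are only finitely many integral points, it stays optimal when lam
    moves slightly: near lam, g_z is the affine function sending mu to
    sum b z - sum_k mu_k N_k, where N_k is the load of k under z. On the other
    hand g_n(mu) = sum_k exp(mu_k - 1), attained exactly at n_k = exp(mu_k - 1).
    Stationarity of the dual at lam therefore reads N_k = n_k, so (z, n) is
    feasible for the mixed-integer problem; weak duality gives optimality. *)

Require Import Defs.
From mathcomp Require Import all_boot all_order all_algebra.
From mathcomp Require Import boolp classical_sets reals exp.
From mathcomp Require Import sequences ring lra.

Set Implicit Arguments.
Unset Strict Implicit.
Unset Printing Implicit Defensive.

Import Order.TTheory GRing.Theory Num.Theory.
Local Open Scope ring_scope.

(** * Integrality of fractional perfect matchings in a bipartite multigraph *)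

Section BipartiteIntegrality.

Variables (R : realFieldType) (E Cm Cp : finType).
Variables (cl : E -> option Cm) (rl : E -> option Cp).

(** An endpoint [None] is a virtual node: it carries no constraint, so it is not a vertex here. *)
Definition incident (e : E) (w : Cm + Cp) : bool :=
  match w with inl i => cl e == Some i | inr j => rl e == Some j end.

Definition fractional_matching (z : E -> R) : Prop :=
  (forall e, 0 <= z e <= 1) /\ forall w, \sum_(e | incident e w) z e = 1.

Definition fractional_part (z : E -> R) : {set E} := [set e | 0 < z e < 1].

Lemma sum_eq_Some (S : nzSemiRingType) (I : finType) (o : option I) :
  \sum_i ((o == Some i)%:R : S) = (isSome o)%:R.
Proof.
case: o => [i0|]; last by rewrite big1.
rewrite (bigD1 i0) //= eqxx big1 ?addr0 // => i ne_i.
by rewrite (inj_eq Some_inj) eq_sym (negPf ne_i).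
Qed.

Lemma sum_incident (e : E) :
  \sum_w (incident e w : nat) = (isSome (cl e) + isSome (rl e))%N.
Proof.
rewrite big_sumType /=.
have H (I : finType) (o : option I) : \sum_i ((o == Some i) : nat) = isSome o.
  have := sum_eq_Some nat o; rewrite !natn => <-.
  by apply: eq_bigr => i _; rewrite natn.
by rewrite !H.
Qed.

Lemma signed_sum_incident (e : E) :
  \sum_w (incident e w)%:R * (if w is inl _ then 1 else -1) =
  (isSome (cl e))%:R - (isSome (rl e))%:R :> R.
Proof.
rewrite big_sumType /= -!sum_eq_Some -sumrN.
by congr (_ + _); apply: eq_bigr => i _; rewrite ?mulr1 ?mulrN1.
Qed.

(* Either the incidence matrix of [F] has a left kernel, or it is square and
   invertible; in the latter case every edge of [F] has two endpoints, and the
   +1/-1 vector of the bipartition lies in the right kernel. *)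
Lemma exists_circulation (F : {set E}) :
    F != finset.set0 ->
    (forall w e, e \in F -> incident e w ->
       exists2 e', e' \in F & (e' != e) && incident e' w) ->
  exists d : E -> R, [/\ exists e, d e != 0, forall e, e \notin F -> d e = 0
    & forall w, \sum_(e | incident e w) d e = 0].
Proof.
move=> /finset.set0Pn [e0 e0F] deg2.
pose V : {set Cm + Cp} := [set w | [exists e in F, incident e w]].
have inV e w : e \in F -> incident e w -> w \in V.
  by move=> eF ew; rewrite inE; apply/existsP; exists e; rewrite eF.
(* Double counting of incidences: every vertex of [V] meets at least two edges of [F]. *)
have leV : (2 * #|V| <= \sum_(e in F) (isSome (cl e) + isSome (rl e)))%N.
  under eq_bigr do rewrite -sum_incident.
  rewrite exchange_big /= mulnC -sum_nat_const.
  rewrite [leqRHS](bigID (mem V)) /= -[leqLHS]addn0 leq_add //.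
  apply: leq_sum => w; rewrite inE => /existsP [e /andP[eF ew]].
  have [e' e'F /andP[ne e'w]] := deg2 w e eF ew.
  by rewrite (bigD1 e) //= (bigD1 e') ?e'F //= ew e'w.
(* Rows are edges and columns vertices, so a row vector killed by [M], extended by 0 outside [F], is
   the desired [d]. *)
pose M : 'M[R]_(#|F|, #|V|) :=
  \matrix_(a, b) (incident (enum_val a) (enum_val b))%:R.
have [/eqP kM|/rowV0Pn [u /sub_kermxP uM u0]] := boolP (kermx M == 0).
(* Independent rows give [#|F| <= #|V|], the degree count gives [2 * #|V| <= 2 * #|F|]; equality
   throughout leaves no edge of [F] with a virtual endpoint. *)
- have rM : \rank M = #|F|.
    by move: kM => /eqP; rewrite kermx_eq0 /row_free => /eqP.
  have leFV : (#|F| <= #|V|)%N by rewrite -{1}rM rank_leq_col.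
  have le2 e : (isSome (cl e) + isSome (rl e) <= 2)%N by case: (cl e) (rl e) => [?|] [?|].
  have leVF : (\sum_(e in F) (isSome (cl e) + isSome (rl e)) <= 2 * #|F|)%N.
    by rewrite mulnC -sum_nat_const; apply: leq_sum.
  have eqFV : #|F| = #|V|.
    by apply/eqP; rewrite eqn_leq leFV -(leq_pmul2l (isT : 0 < 2)%N) (leq_trans leV).
  have both e : e \in F -> isSome (cl e) && isSome (rl e).
    move=> eF; apply: contraTT leV => nb; rewrite -ltnNge -eqFV mulnC -sum_nat_const.
    rewrite (bigD1 e) //= [ltnRHS](bigD1 e) //= -addSn leq_add //; last exact: leq_sum.
    by case: (cl e) (rl e) nb => [?|] [?|].
  have /row_fullP [B BM] : row_full M by rewrite /row_full rM eqFV.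
  pose c : 'cV[R]_#|V| := \col_b (if enum_val b is inl _ then 1 else -1).
  have Mc : M *m c = 0.
    apply/colP => a; rewrite !mxE.
    have aF := enum_valP a.
    transitivity (\sum_(w in V) (incident (enum_val a) w)%:R *
                    (if w is inl _ then 1 else -1) : R).
      by rewrite [RHS]big_enum_val; apply: eq_bigr => b _; rewrite !mxE.
    have := signed_sum_incident (enum_val a).
    have /andP[-> ->] := both _ aF; rewrite subrr => sgn0.
    rewrite -[RHS]sgn0 [RHS](bigID (mem V)) /= [X in _ + X]big1 ?addr0 // => w wV.
    by rewrite (contraNF (inV _ _ aF) wV) mul0r.
  have c0 : c = 0 by rewrite -[c]mul1mx -BM -mulmxA Mc mulmx0.
  have V0 : (0 < #|V|)%N by rewrite -eqFV; apply/card_gt0P; exists e0.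
  have /colP /(_ (Ordinal V0)) := c0; rewrite !mxE.
  by case: (enum_val _) => _ /eqP; rewrite ?oppr_eq0 oner_eq0.
- pose d e := if e \in F then u 0 (enum_rank_in e0F e) else 0.
  exists d; split.
  + have /rV0Pn [a ua] := u0; exists (enum_val a).
    by rewrite /d enum_valP enum_valK_in.
  + by move=> e eF; rewrite /d (negPf eF).
  + move=> w; have [wV|wV] := boolP (w \in V); last first.
      apply: big1 => e ew; rewrite /d; case: ifP => // eF.
      by rewrite (inV _ _ eF ew) in wV.
    have /rowP /(_ (enum_rank_in wV w)) := uM; rewrite !mxE => uMw; rewrite -[RHS]uMw.
    transitivity (\sum_(e in F) d e * (incident e w)%:R).
      rewrite (bigID (mem F)) /= [X in _ + X]big1 ?addr0; last first.
        by move=> e /andP[_ eF]; rewrite /d (negPf eF).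
      rewrite big_mkcond [RHS]big_mkcond; apply: eq_bigr => e _.
      by rewrite andbC; case: (e \in F) (incident e w) => [] [] //=; rewrite ?mulr1 ?mulr0.
    rewrite big_enum_val; apply: eq_bigr => a _.
    by rewrite mxE enum_rankK_in // /d enum_valP enum_valK_in.
Qed.

Lemma not_fractional (z : E -> R) (e : E) :
  0 <= z e <= 1 -> e \notin fractional_part z -> z e = (z e == 1)%:R.
Proof.
rewrite inE => /andP[z0 z1]; rewrite !lt_neqAle z0 z1 !andbT negb_and !negbK.
by move=> /orP[/eqP <-|/eqP ->]; rewrite ?eqxx // eq_sym oner_eq0.
Qed.

(** The values at [w] sum to 1; if all but one of them are 0 or 1, the last is an integer too. *)
Lemma fractional_part_degree (z : E -> R) :
  fractional_matching z -> forall w e, e \in fractional_part z -> incident e w ->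
  exists2 e', e' \in fractional_part z & (e' != e) && incident e' w.
Proof.
move=> [z01 zw] w e eF ew; apply: contrapT => noe.
have others e' : incident e' w && (e' != e) -> z e' = (z e' == 1)%:R.
  move=> /andP[e'w ne]; apply: not_fractional => //.
  by apply/negP => e'F; apply: noe; exists e'; rewrite ?ne.
have := zw w; rewrite (bigD1 e) //= (eq_bigr _ others) -natr_sum.
move: eF; rewrite inE => /andP[ze0 ze1].
case: (\sum_(_ <- _ | _) _)%N => [|m] eq1; first by rewrite -eq1 addr0 ltxx in ze1.
have : 1 <= m.+1%:R :> R by rewrite ler1n.
by move=> m1; lra.
Qed.

(* Move along a circulation until a coordinate becomes integral. *)
Lemma shrink_fractional_part (c z : E -> R) :
    fractional_matching z -> fractional_part z != finset.set0 ->
  exists z' : E -> R, [/\ fractional_matching z',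
    (#|fractional_part z'| < #|fractional_part z|)%N
    & \sum_e c e * z e <= \sum_e c e * z' e].
Proof.
move=> zm F0; have [z01 zw] := zm.
(* Up to replacing [d] by its opposite, the objective does not decrease along [d]. *)
have [d [[e0 de0] dF dw cd]] : exists d : E -> R,
   [/\ exists e, d e != 0, forall e, e \notin fractional_part z -> d e = 0,
     forall w, \sum_(e | incident e w) d e = 0 & 0 <= \sum_e c e * d e].
  have [d [[e0 de0] dF dw]] := exists_circulation F0 (fractional_part_degree zm).
  have [cd|cd] := leP 0 (\sum_e c e * d e); first by exists d; split=> //; exists e0.
  exists (fun e => - d e); split.
  - by exists e0; rewrite oppr_eq0.
  - by move=> e eF; rewrite dF ?oppr0.
  - by move=> w; rewrite sumrN dw oppr0.
  - by under eq_bigr do rewrite mulrN; rewrite sumrN oppr_ge0 ltW.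
(* The step length at which coordinate [e] reaches 1 (if [d e] is positive) or 0 (if negative). The
   least such length keeps all coordinates in the unit interval. *)
pose r e := if 0 < d e then (1 - z e) / d e else - z e / d e.
have supF e : d e != 0 -> 0 < z e < 1.
  by move=> de; have : e \in fractional_part z; [apply: contraNT de => /dF -> | rewrite inE].
case: (@arg_minP _ R E e0 (fun e => d e != 0) r de0) => e1 de1 rmin.
have r_ge0 : 0 <= r e1.
  have /andP[z0 z1] := supF _ de1; rewrite /r; case: ltP => d1.
    by rewrite divr_ge0 ?subr_ge0 // ltW.
  by rewrite mulNr -mulrN -invrN divr_ge0 ?oppr_ge0 // ltW.
exists (fun e => z e + r e1 * d e); split; first split.
- move=> e; have [->|de] := eqVneq (d e) 0; first by rewrite mulr0 addr0.
  have /andP[z0 z1] := supF _ de; have := rmin _ de; rewrite {2}/r.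
  case: ltP => dpos; first by rewrite ler_pdivlMr // => ?; have := mulr_ge0 r_ge0 (ltW dpos); lra.
  have dneg : d e < 0 by rewrite lt_neqAle de.
  rewrite ler_ndivlMr // => ?; have := mulr_ge0_le0 r_ge0 dpos; lra.
- by move=> w; rewrite big_split /= zw -mulr_sumr dw mulr0 addr0.
- apply: proper_card; apply/properP; split.
    apply/fintype.subsetP => e; apply: contraTT => eF.
    by move: (eF); rewrite !inE dF // mulr0 addr0.
  exists e1; first by rewrite inE supF.
  rewrite inE /r; case: (ltP 0 (d e1)) => _; rewrite divfK //; first by rewrite addrC subrK ltxx andbF.
  by rewrite subrr ltxx.
- under [leRHS]eq_bigr do rewrite mulrDr mulrCA.
  by rewrite big_split /= lerDl -mulr_sumr mulr_ge0.
Qed.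

(** Induction on the number of fractional coordinates; once none is left, [z] itself is
    0/1-valued. *)
Lemma exists_integral_matching (c z : E -> R) :
  fractional_matching z ->
  exists x : {ffun E -> bool}, fractional_matching (fun e => (x e)%:R) /\
    \sum_e c e * z e <= \sum_e c e * (x e)%:R.
Proof.
have [n] := ubnP #|fractional_part z|; elim: n z => // n IHn z leF zm.
have [F0|F0] := eqVneq (fractional_part z) finset.set0.
  pose x := [ffun e => z e == 1].
  have xE : (fun e => (x e)%:R) = z.
    apply: funext => e; rewrite ffunE -not_fractional // ?F0 ?inE //.
    by case: zm.
  exists x; split; first by rewrite xE.
  by apply: ler_sum => e _; rewrite -(congr1 (@^~ e) xE).
have [z' [z'm ltF le_c]] := shrink_fractional_part c zm F0.
have [|x [xm le_x]] := IHn z' _ z'm; first exact: leq_trans ltF _.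
by exists x; split=> //; apply: le_trans le_x.
Qed.

End BipartiteIntegrality.

Local Open Scope classical_set_scope.
Local Open Scope ring_scope.

(** * Attained optimal values and entropy inequalities *)

Lemma max_value_maximizer (R : realType) (X : Type) (S : set X) (f : X -> R) x :
  is_maximizer S f x -> max_value S f = f x.
Proof.
move=> [Sx fx]; apply/eqP; rewrite eq_le /max_value; apply/andP; split.
  by apply: ge_sup; [exists (f x), x | move=> _ [y Sy <-]; exact: fx].
by apply: ub_le_sup; [exists (f x) => _ [y Sy <-]; exact: fx | exists x].
Qed.

(** For positive [n] and [y = l - 1 - ln n], this is [1 + y <= expR y] multiplied by [n]. *)
Lemma entropy_le_expR (R : realType) (l n : R) :
  0 <= n -> n * (l - ln n) <= expR (l - 1).
Proof.
rewrite le_eqVlt => /orP[/eqP <-|n0]; first by rewrite mul0r expR_ge0.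
have -> : l - 1 = ln n + (l - 1 - ln n) by ring.
rewrite expRD lnK // ler_pM2l //.
by have := expR_ge1Dx (l - 1 - ln n); lra.
Qed.

Lemma entropy_lt_expR (R : realType) (l n : R) :
  0 <= n -> n != expR (l - 1) -> n * (l - ln n) < expR (l - 1).
Proof.
rewrite le_eqVlt => /orP[/eqP <- _|n0 ne]; first by rewrite mul0r expR_gt0.
have ne0 : l - 1 - ln n != 0.
  by apply: contraNneq ne => /subr0_eq ->; rewrite lnK.
have -> : l - 1 = ln n + (l - 1 - ln n) by ring.
rewrite expRD lnK // ltr_pM2l //.
by have := expR_gt1Dx ne0; lra.
Qed.

Lemma entropy_expR (R : realType) (l : R) :
  expR (l - 1) * (l - ln (expR (l - 1))) = expR (l - 1).
Proof. by rewrite expRK; ring. Qed.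

(* The hypothesis says that [N] is a subgradient at 0 of [s |-> n * expR s]. *)
Lemma expR_subgradient (R : realType) (n N d : R) :
  0 < n -> 0 < d -> (forall s, `|s| <= d -> s * N <= n * (expR s - 1)) -> N = n.
Proof.
move=> n0 d0 sub; apply/eqP; rewrite eq_le !leNgt; apply/andP; split; apply/negP.
- move=> ltnN; have N0 := lt_trans n0 ltnN.
  have r0 : 0 < ln (N / n) by rewrite ln_gt0 // ltr_pdivlMr // mul1r.
  (* Since [s < ln (N / n)], [n * (expR s - 1) <= s * (n * expR s) < s * N], against [sub]. *)
  pose s := Num.min d (ln (N / n) / 2).
  have s0 : 0 < s by rewrite lt_min d0 divr_gt0.
  have := sub s; rewrite gtr0_norm // ge_min lexx => /(_ isT).
  apply/negP; rewrite -ltNge.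
  have es : n * expR s < N.
    have : expR s < expR (ln (N / n)).
      by rewrite ltr_expR gt_min; apply/orP; right; lra.
    by rewrite lnK ?posrE ?divr_gt0 // ltr_pdivlMr // mulrC.
  have : expR s - 1 <= s * expR s.
    have := expR_ge1Dx (- s); rewrite expRN => h.
    have := expR_gt0 s => e0.
    move: h; rewrite -(ler_pM2r e0) mulVf ?gt_eqF // => h; lra.
  move=> h; have : n * (expR s - 1) <= s * (n * expR s) by rewrite mulrCA ler_pM2l.
  by move=> /le_lt_trans -> //; rewrite ltr_pM2l.
(* Here [N < n * (1 - s) <= n * expR (- s)], and [sub] fails at [- s]. *)
- move=> ltNn; pose s := Num.min d ((n - N) / (2 * n)).
  have s0 : 0 < s by rewrite lt_min d0 divr_gt0 ?subr_gt0 ?mulr_gt0.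
  have := sub (- s); rewrite normrN gtr0_norm // ge_min lexx => /(_ isT).
  apply/negP; rewrite -ltNge.
  have sn : s * n < n - N.
    have : s <= (n - N) / (2 * n) by rewrite ge_min lexx orbT.
    rewrite ler_pdivlMr ?mulr_gt0 //; lra.
  have : expR (- s) - 1 <= - s * expR (- s).
    have := expR_ge1Dx s => h.
    have e0 := expR_gt0 (- s).
    move: h; rewrite -(ler_pM2r e0) -expRD subrr expR0 => h; lra.
  move=> h; have : n * (expR (- s) - 1) <= - s * (n * expR (- s)) by rewrite mulrCA ler_pM2l.
  move=> /le_lt_trans -> //; rewrite !mulNr ltrN2 ltr_pM2l //.
  apply: lt_le_trans (_ : n * (1 - s) <= _); first lra.
  by rewrite ler_pM2l // expR_ge1Dx.
Qed.

(** * Lagrangian duality for the assignment problem *)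

Section Duality.

Variables (R : realType) (A Cm Cp : finType).
Implicit Types (lam n : {ffun A -> R}) (z : assignment R A Cm Cp).
Implicit Types (zn : assignment R A Cm Cp * {ffun A -> R}) (x : {ffun link Cm Cp * A -> bool}).

Lemma gn_maximizer lam :
  is_maximizer (@nonneg_loads R A) (gn_objective lam) [ffun k => expR (lam k - 1)].
Proof.
split=> [k|n n0]; first by rewrite ffunE expR_ge0.
by apply: ler_sum => k _; rewrite ffunE entropy_expR entropy_le_expR.
Qed.

Lemma gn_maximizer_unique lam n :
  is_maximizer (@nonneg_loads R A) (gn_objective lam) n ->
  n = [ffun k => expR (lam k - 1)].
Proof.
move=> [n0 nmax]; apply/ffunP => k; rewrite ffunE; apply: contrapT => /eqP ne.
have := nmax _ (gn_maximizer lam).1; apply/negP; rewrite -ltNge.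
rewrite /gn_objective (bigD1 k) //= [ltRHS](bigD1 k) //= ltr_leD //.
  by rewrite ffunE entropy_expR entropy_lt_expR.
by apply: ler_sum => j _; rewrite ffunE entropy_expR entropy_le_expR.
Qed.

Lemma gnE lam : gn lam = \sum_k expR (lam k - 1).
Proof.
rewrite /gn (max_value_maximizer (gn_maximizer lam)).
by apply: eq_bigr => k _; rewrite ffunE entropy_expR.
Qed.

Definition load z (k : A) : R := \sum_(t : link Cm Cp) weight R t * z (t, k).

Lemma load_ge0 z k : (forall e, 0 <= z e) -> 0 <= load z k.
Proof.
move=> z0; apply: sumr_ge0 => t _; rewrite mulr_ge0 // /weight.
by case: (client t) (relay t) => [?|] [?|].
Qed.

Definition edge_client (e : link Cm Cp * A) := client e.1.
Definition edge_relay (e : link Cm Cp * A) := relay e.1.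

Lemma sum_edges (P : pred (link Cm Cp)) (F : link Cm Cp * A -> R) :
  \sum_(k : A) \sum_(t | P t) F (t, k) = \sum_(e | P e.1) F e.
Proof.
by rewrite exchange_big /= pair_big /=; apply: eq_big => [[t k]|[t k]] //=; rewrite andbT.
Qed.

(** The edges are the pairs of a link and an access point: each link yields [#|A|] parallel
    edges. *)
Lemma relaxed_feasibleE z :
  relaxed_feasible z <-> fractional_matching edge_client edge_relay z.
Proof.
split=> [[z01 zc zr]|[z01 zw]].
  split=> [[t k]|[i|j]]; first exact: z01.
    by rewrite -(zc i) sum_edges.
  by rewrite -(zr j) sum_edges.
split=> [t k|i|j]; first exact: z01.
  by rewrite -[RHS](zw (inl i)) sum_edges.
by rewrite -[RHS](zw (inr j)) sum_edges.
Qed.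

Definition integral_assignment x : assignment R A Cm Cp := [ffun e => (x e)%:R].

Variable b : link Cm Cp -> A -> R.

Lemma gz_objectiveE lam z :
  gz_objective b lam z = \sum_e (b e.1 e.2 - lam e.2 * weight R e.1) * z e.
Proof.
by rewrite -(sum_edges predT (fun e => (b e.1 e.2 - lam e.2 * weight R e.1) * z e)).
Qed.

Lemma gz_objective_load lam z :
  gz_objective b lam z =
  \sum_k \sum_t b t k * z (t, k) - \sum_k lam k * load z k.
Proof.
rewrite -sumrB; apply: eq_bigr => k _; rewrite /load mulr_sumr -sumrB.
by apply: eq_bigr => t _; rewrite mulrBl mulrA.
Qed.

Lemma exists_integral_assignment lam z : relaxed_feasible z ->
  exists x, relaxed_feasible (integral_assignment x) /\
    gz_objective b lam z <= gz_objective b lam (integral_assignment x).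
Proof.
move=> /relaxed_feasibleE /(exists_integral_matching
  (fun e => b e.1 e.2 - lam e.2 * weight R e.1)) [x [xm le_x]].
exists x; split.
  apply/relaxed_feasibleE; have [x01 xw] := xm.
  by split=> [e|w]; [rewrite ffunE | rewrite -[RHS](xw w); apply: eq_bigr => e _; rewrite ffunE].
by rewrite !gz_objectiveE (le_trans le_x) // ler_sum // => e _; rewrite ffunE.
Qed.

(** Some integral feasible point does at least as well as [z], so it is a maximizer and equals
    [z]. *)
Lemma unique_maximizer_integral lam z :
  is_maximizer (@relaxed_feasible R A Cm Cp) (gz_objective b lam) z ->
  (forall z', is_maximizer (@relaxed_feasible R A Cm Cp) (gz_objective b lam) z' -> z' = z) ->
  exists x, z = integral_assignment x.
Proof.
move=> [zf zmax] zuniq; have [x [xf le_x]] := exists_integral_assignment lam zf.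
exists x; apply/esym/zuniq; split=> // y yf.
exact: le_trans (zmax _ yf) le_x.
Qed.

Definition shift lam (k : A) (s : R) : {ffun A -> R} :=
  [ffun k' => lam k' + s * (k' == k)%:R].

Lemma gz_objective_shift lam k s z :
  gz_objective b (shift lam k s) z = gz_objective b lam z - s * load z k.
Proof.
rewrite !gz_objective_load -addrA; congr (_ + _); rewrite -opprD; congr (- _).
under eq_bigr do rewrite ffunE mulrDl.
rewrite big_split /=; congr (_ + _).
rewrite (bigD1 k) //= eqxx mulr1 big1 ?addr0 // => j /negPf ->.
by rewrite mulr0 mul0r.
Qed.

Lemma gn_shift lam k s :
  gn (shift lam k s) = gn lam + expR (lam k - 1) * (expR s - 1).
Proof.
rewrite !gnE (bigD1 k) //= [in RHS](bigD1 k) //= ffunE eqxx mulr1.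
rewrite [RHS]addrAC; congr (_ + _).
  by rewrite addrAC (expRD (lam k - 1)); ring.
by apply: eq_bigr => j /negPf ne; rewrite ffunE ne mulr0 addr0.
Qed.

Lemma finite_common_radius (I : finType) (P : I -> R -> Prop) :
  (forall i, exists2 d, 0 < d & forall s, `|s| <= d -> P i s) ->
  exists2 d, 0 < d & forall i s, `|s| <= d -> P i s.
Proof.
move=> Pd.
have [i|d dP] := @boolp.choice I R (fun i d => 0 < d /\ forall s, `|s| <= d -> P i s).
  by have [d] := Pd i; exists d.
(* The initial value 1 keeps the radius positive when [I] is empty. *)
exists (\big[Num.min/1]_i d i).
  by apply/bigmin_gtP; split=> // i _; exact: (dP i).1.
move=> i s sd; apply: (dP i).2; apply: le_trans sd _.
exact: bigmin_le_cond.
Qed.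

(* The other integral assignments are finitely many and strictly worse at
   [lam], hence remain worse after a small change of [lam k]. *)
Lemma unique_maximizer_stable lam z k :
  is_maximizer (@relaxed_feasible R A Cm Cp) (gz_objective b lam) z ->
  (forall z', is_maximizer (@relaxed_feasible R A Cm Cp) (gz_objective b lam) z' -> z' = z) ->
  exists2 d, 0 < d & forall s, `|s| <= d ->
    is_maximizer (@relaxed_feasible R A Cm Cp) (gz_objective b (shift lam k s)) z.
Proof.
move=> [zf zmax] zuniq.
have [x|d d0 dP] := @finite_common_radius {ffun link Cm Cp * A -> bool}
    (fun x s => relaxed_feasible (integral_assignment x) ->
       gz_objective b (shift lam k s) (integral_assignment x) <=
       gz_objective b (shift lam k s) z); last first.
  exists d => // s sd; split=> // y yf.
  have [x [xf le_x]] := exists_integral_assignment (shift lam k s) yf.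
  exact: le_trans le_x (dP _ _ sd xf).
have [<-|/eqP ne] := eqVneq (integral_assignment x) z; first by exists 1.
have [xf|] := pselect (relaxed_feasible (integral_assignment x)); last by exists 1.
have gap : 0 < gz_objective b lam z - gz_objective b lam (integral_assignment x).
  rewrite subr_gt0 ltNge; apply/negP => le_zx; apply: ne; apply: zuniq.
  by split=> // y yf; apply: le_trans (zmax _ yf) le_zx.
pose N := `|load z k - load (integral_assignment x) k|.
have N1 : 0 < 1 + N by rewrite ltr_wpDr ?normr_ge0.
(* A shift by [s] changes the gap by at most [|s| * N]; the added 1 avoids dividing by zero when the
   loads agree. *)
exists ((gz_objective b lam z - gz_objective b lam (integral_assignment x)) / (1 + N)).
  exact: divr_gt0.
move=> s; rewrite ler_pdivlMr // => sN _; rewrite !gz_objective_shift.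
have : s * (load z k - load (integral_assignment x) k) <= `|s| * (1 + N).
  apply: le_trans (ler_norm _) _; rewrite normrM ler_wpM2l // -/N; lra.
lra.
Qed.

(** For small [s], shifting [lam k] by [s] changes the dual objective by [expR (lam k - 1) * (expR s
    - 1) - s * load z k], which minimality makes nonnegative. *)
Lemma load_dual_optimal lam z :
  is_minimizer setT (dual_objective b) lam ->
  is_maximizer (@relaxed_feasible R A Cm Cp) (gz_objective b lam) z ->
  (forall z', is_maximizer (@relaxed_feasible R A Cm Cp) (gz_objective b lam) z' -> z' = z) ->
  forall k, load z k = expR (lam k - 1).
Proof.
move=> [_ lam_min] zmax zuniq k.
have [d d0 dP] := unique_maximizer_stable k zmax zuniq.
apply: (@expR_subgradient R _ _ d) => // [|s sd]; first exact: expR_gt0.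
have := lam_min (shift lam k s) I.
rewrite /dual_objective gn_shift /gz (max_value_maximizer zmax).
rewrite (max_value_maximizer (dP s sd)) gz_objective_shift; lra.
Qed.

(** The coupling of [n] to the loads of [z] cancels the two terms in [lam]. *)
Lemma mip_objective_lagrangian lam zn : mip_feasible zn ->
  mip_objective b zn = gz_objective b lam zn.1 + gn_objective lam zn.2.
Proof.
move=> [_ _ _ nE]; rewrite gz_objective_load -addrA; congr (_ + _).
rewrite addrC -sumrB -sumrN; apply: eq_bigr => k _.
by rewrite -[load _ _]nE; ring.
Qed.

Lemma mip_feasible_relaxed zn : mip_feasible zn -> relaxed_feasible zn.1.
Proof.
move=> [z01 zc zr _]; split=> // t k.
by case: (z01 t k) => ->; rewrite lexx ler01.
Qed.

Lemma mip_feasible_nonneg zn : mip_feasible zn -> nonneg_loads zn.2.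
Proof.
move=> /[dup] /mip_feasible_relaxed [z01 _ _] [_ _ _ nE] k.
by rewrite nE; apply: load_ge0 => -[t j]; case/andP: (z01 t j).
Qed.

End Duality.

Theorem mainTheorem3 (R : realType) (A Cm Cp : finType)
  (A_neq0 : (0 < #|A|)%N)
  (cik : Cm -> A -> R) (cij : Cm -> Cp -> R) (cjk : Cp -> A -> R)
  (cik_gt0 : forall i k, 0 < cik i k)
  (cij_gt0 : forall i j, 0 < cij i j)
  (cjk_gt0 : forall j k, 0 < cjk j k)
  (lam_opt n_opt : {ffun A -> R}) (z_opt : assignment R A Cm Cp)
  (lam_optP :
    is_minimizer setT (dual_objective (utility cik cij cjk)) lam_opt)
  (n_optP : is_maximizer (@nonneg_loads R A) (gn_objective lam_opt) n_opt)
  (z_optP : is_maximizer (@relaxed_feasible R A Cm Cp)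
              (gz_objective (utility cik cij cjk) lam_opt) z_opt)
  (z_opt_unique : forall z : assignment R A Cm Cp,
    is_maximizer (@relaxed_feasible R A Cm Cp)
      (gz_objective (utility cik cij cjk) lam_opt) z -> z = z_opt) :
  is_maximizer (@mip_feasible R A Cm Cp)
    (mip_objective (utility cik cij cjk)) (z_opt, n_opt).
Proof.
have feas : mip_feasible (z_opt, n_opt).
  have [x xE] := unique_maximizer_integral z_optP z_opt_unique.
  have [[_ zc zr] _] := z_optP; split=> //= [t k|k].
    by rewrite xE ffunE; case: (x _); [right | left].
  rewrite (gn_maximizer_unique n_optP) ffunE.
  by rewrite -(load_dual_optimal lam_optP z_optP z_opt_unique).
(* Weak duality: at the multiplier [lam_opt] the objective splits, and each half is bounded by its
   maximum over a relaxed set. *)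
split=> // zn znf; rewrite !(mip_objective_lagrangian _ lam_opt) //=.
apply: lerD; first exact: z_optP.2 (mip_feasible_relaxed znf).
exact: n_optP.2 (mip_feasible_nonneg znf).
Qed.
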